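(* Let $(v,R,w)$ be a $C^\infty$ solution of the Euler--plate system described in the context on a time interval $(0,T)$. Then the function $g=\log R$ satisfies the hyperbolic equation $$Q^2g-\operatorname{div}_a(f\nabla_a g)=F\quad\text{in }\Omega\times(0,T)$$ with the boundary conditions $$f\nabla_a g\cdot\nu=h\ \text{ on }\Gamma_1\times(0,T),\qquad \partial_3 g=0\ \text{ on }\Gamma_0\times(0,T),$$ where $f=q'(R)$, $$F=-\partial_ta_{ji}\partial_jv_i+a_{mi}\partial_m(v_ja_{kj})\partial_kv_i-\partial_ka_{mi}\,v_ja_{kj}\,\partial_mv_i-a_{mi}\partial_m(\psi_ta_{33})\partial_3v_i+\partial_3a_{mi}\,\psi_ta_{33}\,\partial_mv_i,$$ and $$h=\partial_tb_{3i}\,v_i-w_{tt}+\sum_{j=1}^2\partial_jb_{3i}\,v_la_{jl}v_i-\sum_{j=1}^2\partial_jw_t\,v_la_{jl}.$$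
   Context: Geometry. $\Omega=\mathbb{T}^2\times[0,1]$, $\Gamma_1=\mathbb{T}^2\times\{1\}$, $\Gamma_0=\mathbb{T}^2\times\{0\}$; all functions are periodic in $x_1,x_2$. Repeated indices are summed over $1,2,3$. $\Delta_{\mathrm h}=\partial_1^2+\partial_2^2$. Pressure law. $q$ is a given smooth function of the density, with $c_1\le q'\le c_2$ on $[m_0/2,2M_0]$ for fixed positive constants $m_0,M_0,c_1,c_2$. Unknowns. $v=(v_1,v_2,v_3)$ and $R>0$ on $\Omega\times[0,T]$, and $w$ scalar on $\Gamma_1\times[0,T]$ with $w(0)=0$. $\psi$ is the harmonic extension: $\Delta\psi=0$ in $\Omega$, $\psi=1+w$ on $\Gamma_1$, $\psi=0$ on $\Gamma_0$. Set $\eta(x,t)=(x_1,x_2,\psi(x,t))$, $J=\partial_3\psi$ (assumed positive), $$a=(\nabla\eta)^{-1}=\begin{pmatrix}1&0&0\\0&1&0\\-\partial_1\psi/\partial_3\psi&-\partial_2\psi/\partial_3\psi&1/\partial_3\psi\end{pmatrix},\qquad b=Ja=\begin{pmatrix}\partial_3\psi&0&0\\0&\partial_3\psi&0\\-\partial_1\psi&-\partial_2\psi&1\end{pmatrix}.$$ Euler--plate system: $$\partial_t v_i+v_ja_{kj}\partial_k v_i-\psi_t a_{33}\partial_3 v_i+\tfrac1R a_{ki}\partial_k(q(R))=0\ \text{ in }\Omega,\quad i=1,2,3,$$ $$R_t+Ra_{ji}\partial_jv_i+v_ia_{ji}\partial_jR-\psi_ta_{33}\partial_3R=0\ \text{ in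 }\Omega,$$ $$w_{tt}+\Delta_{\mathrm h}^2w-\Delta_{\mathrm h}w_t=q(R)\ \text{ on }\Gamma_1,\qquad w_t=b_{3i}v_i\ \text{ on }\Gamma_1,\qquad v_3=0\ \text{ on }\Gamma_0.$$ Notation. $\nu=(b_{31},b_{32},b_{33})^T$; $\operatorname{div}_az=a_{ki}\partial_kz_i$ for a vector field $z$; $(\nabla_ay)_m=a_{km}\partial_ky$ for a scalar $y$; and $$Q=\partial_t+(v-\eta_t)\cdot\nabla_a=\partial_t+v_ia_{ki}\partial_k-\psi_ta_{33}\partial_3 .$$
   Formalization: The density R is additionally assumed to take values in [m_0/2, 2M_0], where c_1 ≤ q' ≤ c_2; otherwise q could be constant on the range of R, and v=0, w=0 with arbitrary R(x) would violate ∂_3 g = 0 on Γ_0. *)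

(* Defs.v *)
From Stdlib Require Import Reals Lra List.
From Coquelicot Require Import Coquelicot.
Open Scope R_scope.

Inductive axis : Set := X1 | X2 | X3.

Inductive coord : Set := Space (k : axis) | Time.
Coercion Space : axis >-> coord.

(* A space-time point is (x1, x2, x3, t). *)
Notation point := (R * R * R * R)%type.

Definition get (c : coord) (p : point) : R :=
  let '(x1, x2, x3, t) := p in
  match c with
  | Space X1 => x1
  | Space X2 => x2
  | Space X3 => x3
  | Time => t
  end.

Definition upd (c : coord) (p : point) (y : R) : point :=
  let '(x1, x2, x3, t) := p in
  match c with
  | Space X1 => (y, x2, x3, t)
  | Space X2 => (x1, y, x3, t)
  | Space X3 => (x1, x2, y, t)
  | Time => (x1, x2, x3, y)
  end.

Definition pd (c : coord) (u : point -> R) (p : point) : R :=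
  Derive (fun y => u (upd c p y)) (get c p).

Definition ex_pd (c : coord) (u : point -> R) (p : point) : Prop :=
  ex_derive (fun y => u (upd c p y)) (get c p).

Definition pd_iter (l : list coord) (u : point -> R) : point -> R :=
  fold_right pd u l.

(* "C^oo on Omega x (0,T)", Omega being closed, means: restriction to
   0 <= x3 <= 1 of a function that is C^oo on R^3 x (0,T).  A field on
   Omega x (0,T) is represented by such an extension, so that at x3 = 0 and
   x3 = 1 the two-sided derivative pd X3 is the one-sided derivative of the
   restriction.  Equations are only ever imposed or asserted on Omega, where
   all derivatives depend on the restriction alone. *)
Definition smooth (T : R) (u : point -> R) : Prop :=
  forall (l : list coord) (p : point), 0 < get Time p < T ->
    continuous (pd_iter l u) p /\ forall c : coord, ex_pd c (pd_iter l u) p.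

Definition Omega (T : R) (p : point) : Prop :=
  0 <= get X3 p <= 1 /\ 0 < get Time p < T.
Definition Gamma1 (T : R) (p : point) : Prop :=
  get X3 p = 1 /\ 0 < get Time p < T.
Definition Gamma0 (T : R) (p : point) : Prop :=
  get X3 p = 0 /\ 0 < get Time p < T.

(* The torus is (R / L Z)^2. *)
Definition periodic (L T : R) (u : point -> R) : Prop :=
  forall p : point, Omega T p ->
    u (upd X1 p (get X1 p + L)) = u p /\ u (upd X2 p (get X2 p + L)) = u p.

(* A function of (x1, x2, t) on Gamma_1, seen as independent of x3. *)
Definition lift (w : R * R * R -> R) (p : point) : R :=
  let '(x1, x2, x3, t) := p in w (x1, x2, t).

Definition sum2 (u : axis -> R) : R := u X1 + u X2.
Definition sum3 (u : axis -> R) : R := u X1 + u X2 + u X3.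

Definition Lap_h (u : point -> R) (p : point) : R :=
  sum2 (fun k => pd k (pd k u) p).
Definition Lap (u : point -> R) (p : point) : R :=
  sum3 (fun k => pd k (pd k u) p).

Definition eta (psi : point -> R) (i : axis) (p : point) : R :=
  match i with
  | X1 => get X1 p
  | X2 => get X2 p
  | X3 => psi p
  end.

Definition J (psi : point -> R) : point -> R := pd X3 psi.

Definition a (psi : point -> R) (i j : axis) (p : point) : R :=
  match i, j with
  | X1, X1 => 1
  | X2, X2 => 1
  | X3, X1 => - pd X1 psi p / pd X3 psi p
  | X3, X2 => - pd X2 psi p / pd X3 psi p
  | X3, X3 => 1 / pd X3 psi p
  | _, _ => 0
  end.

Definition b (psi : point -> R) (i j : axis) (p : point) : R :=
  match i, j with
  | X1, X1 => pd X3 psi p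
  | X2, X2 => pd X3 psi p
  | X3, X1 => - pd X1 psi p
  | X3, X2 => - pd X2 psi p
  | X3, X3 => 1
  | _, _ => 0
  end.

Lemma b_Ja (psi : point -> R) (p : point) (i j : axis) :
  J psi p <> 0 -> b psi i j p = J psi p * a psi i j p.
Proof. unfold J; destruct i, j; simpl; intros; field; trivial. Qed.

Lemma a_inverse (psi : point -> R) (p : point) (i j : axis) :
  J psi p <> 0 ->
  sum3 (fun k => a psi i k p * pd j (eta psi k) p) =
    (match i, j with X1, X1 | X2, X2 | X3, X3 => 1 | _, _ => 0 end).
Proof.
unfold J; intros HJ.
assert (HX1 : pd j (eta psi X1) p = match j with X1 => 1 | _ => 0 end).
{ destruct p as [[[x1 x2] x3] t], j; unfold pd; simpl;
    (apply Derive_id || apply Derive_const). }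
assert (HX2 : pd j (eta psi X2) p = match j with X2 => 1 | _ => 0 end).
{ destruct p as [[[x1 x2] x3] t], j; unfold pd; simpl;
    (apply Derive_id || apply Derive_const). }
unfold sum3; rewrite HX1, HX2.
change (pd j (eta psi X3) p) with (pd j psi p).
destruct i, j; simpl; field; trivial.
Qed.

Definition div_a (psi : point -> R) (z : axis -> point -> R) (p : point) : R :=
  sum3 (fun i => sum3 (fun k => a psi k i p * pd k (z i) p)).

Definition grad_a (psi : point -> R) (y : point -> R) (m : axis) (p : point)
  : R := sum3 (fun k => a psi k m p * pd k y p).

Definition nu (psi : point -> R) (i : axis) : point -> R := b psi X3 i.

Definition Q (v : axis -> point -> R) (psi u : point -> R) (p : point) : R :=
  pd Time u p
  + sum3 (fun i => sum3 (fun k => v i p * a psi k i p * pd k u p))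
  - pd Time psi p * a psi X3 X3 p * pd X3 u p.

Record euler_plate_solution (L T : R) (q : R -> R) (v : axis -> point -> R)
    (rho : point -> R) (w : R * R * R -> R) (psi : point -> R) : Prop := {
  v_smooth : forall i, smooth T (v i);
  rho_smooth : smooth T rho;
  w_smooth : smooth T (lift w);
  psi_smooth : smooth T psi;

  v_periodic : forall i, periodic L T (v i);
  rho_periodic : periodic L T rho;
  w_periodic : periodic L T (lift w);
  psi_periodic : periodic L T psi;

  rho_pos : forall p, Omega T p -> 0 < rho p;

  w_initial : forall x1 x2, w (x1, x2, 0) = 0;
  w_initial_trace : forall x1 x2,
    filterlim (fun t => w (x1, x2, t)) (at_right 0) (locally (w (x1, x2, 0)));

  psi_harmonic : forall p, Omega T p -> Lap psi p = 0;
  psi_top : forall p, Gamma1 T p -> psi p = 1 + lift w p;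
  psi_bottom : forall p, Gamma0 T p -> psi p = 0;
  J_pos : forall p, Omega T p -> 0 < J psi p;

  momentum : forall i p, Omega T p ->
    pd Time (v i) p
    + sum3 (fun j => sum3 (fun k => v j p * a psi k j p * pd k (v i) p))
    - pd Time psi p * a psi X3 X3 p * pd X3 (v i) p
    + 1 / rho p * sum3 (fun k => a psi k i p * pd k (fun x => q (rho x)) p)
    = 0;

  mass : forall p, Omega T p ->
    pd Time rho p
    + rho p * sum3 (fun i => sum3 (fun j => a psi j i p * pd j (v i) p))
    + sum3 (fun i => sum3 (fun j => v i p * a psi j i p * pd j rho p))
    - pd Time psi p * a psi X3 X3 p * pd X3 rho p
    = 0;

  plate : forall p, Gamma1 T p ->
    pd Time (pd Time (lift w)) p + Lap_h (Lap_h (lift w)) p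
    - Lap_h (pd Time (lift w)) p
    = q (rho p);

  kinematic_top : forall p, Gamma1 T p ->
    pd Time (lift w) p = sum3 (fun i => b psi X3 i p * v i p);

  kinematic_bottom : forall p, Gamma0 T p -> v X3 p = 0
}.

Definition source_F (v : axis -> point -> R) (psi : point -> R) (p : point)
  : R :=
  - sum3 (fun i => sum3 (fun j => pd Time (a psi j i) p * pd j (v i) p))
  + sum3 (fun i => sum3 (fun j => sum3 (fun k => sum3 (fun m =>
      a psi m i p * pd m (fun x => v j x * a psi k j x) p * pd k (v i) p))))
  - sum3 (fun i => sum3 (fun j => sum3 (fun k => sum3 (fun m =>
      pd k (a psi m i) p * v j p * a psi k j p * pd m (v i) p))))
  - sum3 (fun i => sum3 (fun m =>
      a psi m i p * pd m (fun x => pd Time psi x * a psi X3 X3 x) p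
      * pd X3 (v i) p))
  + sum3 (fun i => sum3 (fun m =>
      pd X3 (a psi m i) p * pd Time psi p * a psi X3 X3 p * pd m (v i) p)).

Definition boundary_h (v : axis -> point -> R) (w : R * R * R -> R)
    (psi : point -> R) (p : point) : R :=
  sum3 (fun i => pd Time (b psi X3 i) p * v i p)
  - pd Time (pd Time (lift w)) p
  + sum2 (fun j => sum3 (fun i => sum3 (fun l =>
      pd j (b psi X3 i) p * v l p * a psi j l p * v i p)))
  - sum2 (fun j => sum3 (fun l =>
      pd j (pd Time (lift w)) p * v l p * a psi j l p)).

(* Main.v *)
Require Import Defs.
From Stdlib Require Import Reals Lra List.
From Coquelicot Require Import Coquelicot.
Open Scope R_scope.

(** Write $A_i = a_{ki}\partial_k$ for the components of $\nabla_a$, and keep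
    $Q$ for the transport operator.  Dividing the mass equation by $R$ turns
    it into $Qg = -A_i v_i$, and the chain rule turns the momentum equation
    into $f A_i g = -Q v_i$.  Applying $Q$ to the first, $A_i$ to the second,
    and subtracting,
    $$Q^2 g - A_i(f A_i g) = A_i Q v_i - Q A_i v_i = [A_i, Q] v_i .$$
    No second derivative of $v$ survives in this commutator, since partial
    derivatives commute; what remains are derivatives of the coefficients of
    $A_i$ and $Q$ against $\nabla v$, and these are the terms of $F$
    ([grad_a_Q_commutator]).

    On the top boundary, $f\nabla_a g\cdot\nu = -b_{3i} Q v_i$.  There
    $\psi_t = w_t = b_{3i}v_i$, so the coefficient $v_j a_{3j}-\psi_t a_{33}$
    of $\partial_3$ in $Q$ vanishes: $Q$ is tangent to the boundary
    ([Q_tangent_top]).  Its remaining derivatives can be moved from $v_i$ to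
    $b_{3i}$ by differentiating $w_t = b_{3i} v_i$ along the boundary, which
    gives $h$.  On the bottom, $v_3$ and $\psi$ vanish together with their
    tangential derivatives, so the third momentum equation reduces to
    $q'(R)\,a_{33}\,\partial_3 R/R = 0$.

    The equations hold on the closed set $\Omega$ only, whereas the partial
    derivatives are two-sided.  They may be differentiated all the same:
    differentiable functions that agree on a set accumulating at a point along
    a coordinate line have the same partial derivative there
    ([pd_eq_of_non_isolated]). *)

(** * Partial derivatives along coordinate lines *)

Lemma upd_get (c : coord) (p : point) : upd c p (get c p) = p.
Proof. destruct p as [[[x1 x2] x3] t], c as [[]|]; reflexivity. Qed.

Lemma get_upd (c : coord) (p : point) (y : R) : get c (upd c p y) = y.
Proof. destruct p as [[[x1 x2] x3] t], c as [[]|]; reflexivity. Qed.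

Lemma ex_pd_const (c : coord) (r : R) (p : point) : ex_pd c (fun _ => r) p.
Proof. exact (ex_derive_const r (get c p)). Qed.

Lemma ex_pd_opp (c : coord) (u : point -> R) (p : point) :
  ex_pd c u p -> ex_pd c (fun x => - u x) p.
Proof. intros H; exact (ex_derive_opp (fun y => u (upd c p y)) _ H). Qed.

Lemma ex_pd_plus (c : coord) (u1 u2 : point -> R) (p : point) :
  ex_pd c u1 p -> ex_pd c u2 p -> ex_pd c (fun x => u1 x + u2 x) p.
Proof.
intros H1 H2.
exact (ex_derive_plus (fun y => u1 (upd c p y)) (fun y => u2 (upd c p y)) _
  H1 H2).
Qed.

Lemma ex_pd_minus (c : coord) (u1 u2 : point -> R) (p : point) :
  ex_pd c u1 p -> ex_pd c u2 p -> ex_pd c (fun x => u1 x - u2 x) p.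
Proof.
intros H1 H2.
exact (ex_derive_minus (fun y => u1 (upd c p y)) (fun y => u2 (upd c p y)) _
  H1 H2).
Qed.

Lemma ex_pd_mult (c : coord) (u1 u2 : point -> R) (p : point) :
  ex_pd c u1 p -> ex_pd c u2 p -> ex_pd c (fun x => u1 x * u2 x) p.
Proof.
intros H1 H2.
exact (ex_derive_mult (fun y => u1 (upd c p y)) (fun y => u2 (upd c p y)) _
  H1 H2).
Qed.

Lemma ex_pd_div (c : coord) (u1 u2 : point -> R) (p : point) :
  ex_pd c u1 p -> ex_pd c u2 p -> u2 p <> 0 ->
  ex_pd c (fun x => u1 x / u2 x) p.
Proof.
intros H1 H2 H0.
apply (ex_derive_div (fun y => u1 (upd c p y)) (fun y => u2 (upd c p y)) _
  H1 H2).
now rewrite upd_get.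
Qed.

Lemma ex_pd_sum3 (c : coord) (u : axis -> point -> R) (p : point) :
  (forall k, ex_pd c (u k) p) -> ex_pd c (fun x => sum3 (fun k => u k x)) p.
Proof. intros H; unfold sum3; auto using ex_pd_plus. Qed.

Lemma ex_pd_comp (c : coord) (h : R -> R) (u : point -> R) (p : point) :
  ex_derive h (u p) -> ex_pd c u p -> ex_pd c (fun x => h (u x)) p.
Proof.
intros Hh Hu.
apply (ex_derive_comp h (fun y => u (upd c p y))); [|exact Hu].
now rewrite upd_get.
Qed.

Lemma pd_const (c : coord) (r : R) (p : point) : pd c (fun _ => r) p = 0.
Proof. exact (Derive_const r (get c p)). Qed.

Lemma pd_opp (c : coord) (u : point -> R) (p : point) :
  pd c (fun x => - u x) p = - pd c u p.
Proof. apply (Derive_opp (fun y => u (upd c p y))). Qed.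

Lemma pd_plus (c : coord) (u1 u2 : point -> R) (p : point) :
  ex_pd c u1 p -> ex_pd c u2 p ->
  pd c (fun x => u1 x + u2 x) p = pd c u1 p + pd c u2 p.
Proof.
apply (Derive_plus (fun y => u1 (upd c p y)) (fun y => u2 (upd c p y))).
Qed.

Lemma pd_minus (c : coord) (u1 u2 : point -> R) (p : point) :
  ex_pd c u1 p -> ex_pd c u2 p ->
  pd c (fun x => u1 x - u2 x) p = pd c u1 p - pd c u2 p.
Proof.
apply (Derive_minus (fun y => u1 (upd c p y)) (fun y => u2 (upd c p y))).
Qed.

Lemma pd_mult (c : coord) (u1 u2 : point -> R) (p : point) :
  ex_pd c u1 p -> ex_pd c u2 p ->
  pd c (fun x => u1 x * u2 x) p = pd c u1 p * u2 p + u1 p * pd c u2 p.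
Proof.
intros H1 H2; unfold pd at 1.
rewrite (Derive_mult (fun y => u1 (upd c p y)) (fun y => u2 (upd c p y)) _
  H1 H2).
now rewrite !upd_get.
Qed.

Lemma sum3_ext (u1 u2 : axis -> R) :
  (forall k, u1 k = u2 k) -> sum3 u1 = sum3 u2.
Proof. intros H; unfold sum3; now rewrite !H. Qed.

Lemma pd_sum3 (c : coord) (u : axis -> point -> R) (p : point) :
  (forall k, ex_pd c (u k) p) ->
  pd c (fun x => sum3 (fun k => u k x)) p = sum3 (fun k => pd c (u k) p).
Proof. intros H; unfold sum3; rewrite !pd_plus; auto using ex_pd_plus. Qed.

Lemma pd_comp (c : coord) (h : R -> R) (u : point -> R) (p : point) :
  ex_derive h (u p) -> ex_pd c u p ->
  pd c (fun x => h (u x)) p = Derive h (u p) * pd c u p.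
Proof.
intros Hh Hu; unfold pd at 1.
rewrite (Derive_comp h (fun y => u (upd c p y)));
  [|now rewrite upd_get|exact Hu].
rewrite upd_get; unfold pd; ring.
Qed.

Lemma ex_derive_ln (r : R) : 0 < r -> ex_derive ln r.
Proof. intros Hr; exists (/ r); now apply is_derive_ln. Qed.

Lemma pd_ln (c : coord) (u : point -> R) (p : point) :
  0 < u p -> ex_pd c u p -> pd c (fun x => ln (u x)) p = pd c u p / u p.
Proof.
intros Hp Hu.
rewrite pd_comp by auto using ex_derive_ln.
rewrite (is_derive_unique _ _ _ (is_derive_ln _ Hp)).
field; lra.
Qed.

(** * Differentiating an equation that holds on a closed set *)

(** Approach from a single side suffices, which covers at once interior points,
    boundary points, and directions tangent to a boundary. *)
Definition non_isolated (S : point -> Prop) (c : coord) (p : point) : Prop :=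
  S p /\ forall eps, 0 < eps ->
    exists y, y <> get c p /\ Rabs (y - get c p) < eps /\ S (upd c p y).

(** The difference of the two functions vanishes at points whose difference
    quotients determine its derivative. *)
Lemma Derive_eq_of_non_isolated (f1 f2 : R -> R) (x : R) :
  ex_derive f1 x -> ex_derive f2 x -> f1 x = f2 x ->
  (forall eps, 0 < eps ->
     exists y, y <> x /\ Rabs (y - x) < eps /\ f1 y = f2 y) ->
  Derive f1 x = Derive f2 x.
Proof.
intros H1 H2 Hx Hacc.
assert (Hd := is_derive_minus f1 f2 x _ _
  (Derive_correct f1 x H1) (Derive_correct f2 x H2)).
apply is_derive_Reals in Hd.
set (l := Derive f1 x - Derive f2 x).
change (derivable_pt_lim (fun y => f1 y - f2 y) x l) in Hd.
destruct (Req_dec l 0) as [Hl|Hl]; [unfold l in Hl; lra|exfalso].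
destruct (Hd (Rabs l) (Rabs_pos_lt _ Hl)) as [delta Hdelta].
destruct (Hacc delta (cond_pos delta)) as [y [Hy [Hclose Heq]]].
specialize (Hdelta (y - x) (Rminus_eq_contra _ _ Hy) Hclose).
replace (x + (y - x)) with y in Hdelta by ring.
rewrite Heq, Hx in Hdelta.
replace ((f2 y - f2 y - (f2 x - f2 x)) / (y - x) - l) with (- l)
  in Hdelta by (field; lra).
rewrite Rabs_Ropp in Hdelta; lra.
Qed.

Lemma pd_eq_of_non_isolated (S : point -> Prop) (c : coord)
    (u1 u2 : point -> R) (p : point) :
  non_isolated S c p -> (forall x, S x -> u1 x = u2 x) ->
  ex_pd c u1 p -> ex_pd c u2 p -> pd c u1 p = pd c u2 p.
Proof.
intros [Hp Hacc] Heq H1 H2.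
apply Derive_eq_of_non_isolated; [exact H1|exact H2| |].
- rewrite upd_get; auto.
- intros eps Heps.
  destruct (Hacc eps Heps) as [y [Hy [Hclose HS]]].
  exists y; auto.
Qed.

Lemma interval_no_isolated_point (l r x eps : R) :
  l < r -> l <= x <= r -> 0 < eps ->
  exists y, y <> x /\ Rabs (y - x) < eps /\ l <= y <= r.
Proof.
intros Hlr Hx Heps.
destruct (Rlt_dec x r) as [Hxr|Hxr].
- exists (x + Rmin (eps / 2) (r - x)).
  assert (H := Rmin_l (eps / 2) (r - x)).
  assert (H' := Rmin_r (eps / 2) (r - x)).
  assert (0 < Rmin (eps / 2) (r - x)) by (apply Rmin_pos; lra).
  rewrite Rabs_pos_eq; lra.
- exists (x - Rmin (eps / 2) (x - l)).
  assert (H := Rmin_l (eps / 2) (x - l)).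
  assert (H' := Rmin_r (eps / 2) (x - l)).
  assert (0 < Rmin (eps / 2) (x - l)) by (apply Rmin_pos; lra).
  rewrite Rabs_left; lra.
Qed.

Lemma open_interval_no_isolated_point (l r x eps : R) :
  l < x < r -> 0 < eps ->
  exists y, y <> x /\ Rabs (y - x) < eps /\ l < y < r.
Proof.
intros Hx Heps.
destruct (interval_no_isolated_point x ((x + r) / 2) x eps)
  as [y Hy]; try lra.
exists y; intuition lra.
Qed.

Lemma Omega_non_isolated (T : R) (c : coord) (p : point) :
  Omega T p -> non_isolated (Omega T) c p.
Proof.
intros Hp; split; [assumption|intros eps Heps].
destruct p as [[[x1 x2] x3] t]; unfold Omega in *; simpl in Hp.
destruct c as [[]|]; simpl.
- exists (x1 + eps / 2); rewrite Rabs_pos_eq; lra.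
- exists (x2 + eps / 2); rewrite Rabs_pos_eq; lra.
- destruct (interval_no_isolated_point 0 1 x3 eps) as [y Hy]; try lra.
  exists y; tauto.
- destruct (open_interval_no_isolated_point 0 T t eps) as [y Hy]; try lra.
  exists y; tauto.
Qed.

Lemma level_set_non_isolated (T r : R) (c : coord) (p : point) :
  c <> X3 -> get X3 p = r /\ 0 < get Time p < T ->
  non_isolated (fun x => get X3 x = r /\ 0 < get Time x < T) c p.
Proof.
intros Hc Hp; split; [assumption|intros eps Heps].
destruct p as [[[x1 x2] x3] t]; simpl in Hp.
destruct c as [[]|]; simpl.
- exists (x1 + eps / 2); rewrite Rabs_pos_eq; lra.
- exists (x2 + eps / 2); rewrite Rabs_pos_eq; lra.
- now destruct Hc.
- destruct (open_interval_no_isolated_point 0 T t eps) as [y Hy]; try lra.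
  exists y; tauto.
Qed.

Lemma Gamma1_non_isolated (T : R) (c : coord) (p : point) :
  c <> X3 -> Gamma1 T p -> non_isolated (Gamma1 T) c p.
Proof. apply level_set_non_isolated. Qed.

Lemma Gamma0_non_isolated (T : R) (c : coord) (p : point) :
  c <> X3 -> Gamma0 T p -> non_isolated (Gamma0 T) c p.
Proof. apply level_set_non_isolated. Qed.

(** * Smooth fields *)

Lemma smooth_ex_pd (T : R) (u : point -> R) (c : coord) (p : point) :
  smooth T u -> 0 < get Time p < T -> ex_pd c u p.
Proof. intros Hu Hp; exact (proj2 (Hu nil p Hp) c). Qed.

Lemma smooth_pd (T : R) (u : point -> R) (c : coord) :
  smooth T u -> smooth T (pd c u).
Proof.
intros Hu l.
replace (pd_iter l (pd c u)) with (pd_iter (l ++ c :: nil) u)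
  by (unfold pd_iter; now rewrite fold_right_app).
apply Hu.
Qed.

Lemma locally_time (T : R) (c : coord) (p : point) :
  0 < get Time p < T ->
  locally (get c p) (fun y => 0 < get Time (upd c p y) < T).
Proof.
intros Hp; destruct p as [[[x1 x2] x3] t]; simpl in Hp.
destruct c as [[]|]; simpl; try (now apply filter_forall).
apply (open_and (fun y => 0 < y) (fun y => y < T));
  [apply open_gt|apply open_lt|assumption].
Qed.

(** Where [u] is positive it stays so on a piece of each coordinate line, and
    there the derivative of the logarithm is a quotient of smooth fields. *)
Lemma ex_pd_pd_ln (T : R) (u : point -> R) (c k : coord) (p : point) :
  smooth T u -> 0 < get Time p < T -> 0 < u p ->
  ex_pd c (pd k (fun x => ln (u x))) p.
Proof.
intros Hu Hp Hpos.
apply (ex_derive_ext_loc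
  (fun y => pd k u (upd c p y) / u (upd c p y))).
- assert (Hcont : continuous (fun y => u (upd c p y)) (get c p)).
  { apply (ex_derive_continuous (V := R_NormedModule)).
    exact (smooth_ex_pd T u c p Hu Hp). }
  assert (Hloc : locally (get c p) (fun y => 0 < u (upd c p y))).
  { apply Hcont, (open_gt 0); now rewrite upd_get. }
  generalize (filter_and _ _ Hloc (locally_time T c p Hp)).
  apply filter_imp; intros y [Hy Ht].
  symmetry; apply pd_ln; [assumption|now apply (smooth_ex_pd T)].
- apply (ex_pd_div c (pd k u) u p); [| |lra];
    apply (smooth_ex_pd T); auto using smooth_pd.
Qed.

(** Schwarz's theorem concerns functions of two real variables; composing with
    this map turns a field near [p] into one. *)
Definition plane_point (c d : coord) (p : point) (yz : R * R) : point :=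
  upd c (upd d p (snd yz)) (fst yz).

Lemma continuous_plane_point (c d : coord) (p : point) (yz : R * R) :
  continuous (plane_point c d p) yz.
Proof.
assert (Hpair : forall (U V : UniformSpace) (f1 : R * R -> U)
    (f2 : R * R -> V), continuous f1 yz -> continuous f2 yz ->
    continuous (fun x => (f1 x, f2 x)) yz).
{ intros U V f1 f2 H1 H2.
  apply (continuous_comp_2 f1 f2 pair); [assumption..|].
  apply (continuous_ext (fun x => x)); [now intros []|apply continuous_id]. }
destruct p as [[[x1 x2] x3] t]; unfold plane_point.
destruct c as [[]|], d as [[]|]; simpl;
  repeat apply Hpair;
  solve [apply continuous_fst | apply continuous_snd | apply continuous_const].
Qed.

Lemma continuity_2d_plane (u : point -> R) (c d : coord) (p : point) (y z : R) :
  continuous u (plane_point c d p (y, z)) ->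
  continuity_2d_pt (fun y z => u (plane_point c d p (y, z))) y z.
Proof.
intros Hu; apply continuity_2d_pt_filterlim.
apply (continuous_comp (plane_point c d p) u (y, z)
  (continuous_plane_point c d p (y, z))) in Hu.
refine (filterlim_ext _ _ _ Hu); now intros [y' z'].
Qed.

Lemma plane_point_get (c d : coord) (p : point) :
  plane_point c d p (get c p, get d p) = p.
Proof. unfold plane_point; simpl; now rewrite !upd_get. Qed.

Lemma pd_plane_l (c d : coord) (u : point -> R) (p : point) (y z : R) :
  Derive (fun y => u (plane_point c d p (y, z))) y
  = pd c u (plane_point c d p (y, z)).
Proof.
unfold pd, plane_point; simpl; rewrite get_upd.
apply Derive_ext; intros y'.
now destruct p as [[[x1 x2] x3] t], c as [[]|], d as [[]|].
Qed.

Lemma ex_pd_plane_l (c d : coord) (u : point -> R) (p : point) (y z : R) :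
  ex_pd c u (plane_point c d p (y, z)) ->
  ex_derive (fun y => u (plane_point c d p (y, z))) y.
Proof.
unfold ex_pd, plane_point; simpl; rewrite get_upd.
apply ex_derive_ext; intros y'.
now destruct p as [[[x1 x2] x3] t], c as [[]|], d as [[]|].
Qed.

Lemma plane_point_swap (c d : coord) (p : point) (y z : R) :
  c <> d -> plane_point c d p (y, z) = plane_point d c p (z, y).
Proof.
intros Hcd.
destruct p as [[[x1 x2] x3] t], c as [[]|], d as [[]|];
  (reflexivity || now destruct Hcd).
Qed.

Lemma pd_plane_r (c d : coord) (u : point -> R) (p : point) (y z : R) :
  c <> d ->
  Derive (fun z => u (plane_point c d p (y, z))) z
  = pd d u (plane_point c d p (y, z)).
Proof.
intros Hcd; rewrite (plane_point_swap c d p y z Hcd), <- pd_plane_l.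
apply Derive_ext; intros z'; now rewrite plane_point_swap.
Qed.

Lemma ex_pd_plane_r (c d : coord) (u : point -> R) (p : point) (y z : R) :
  c <> d -> ex_pd d u (plane_point c d p (y, z)) ->
  ex_derive (fun z => u (plane_point c d p (y, z))) z.
Proof.
intros Hcd; rewrite (plane_point_swap c d p y z Hcd); intros H.
apply ex_pd_plane_l in H; revert H.
apply ex_derive_ext; intros z'; now rewrite plane_point_swap.
Qed.

Lemma coord_eq_dec (c d : coord) : {c = d} + {c <> d}.
Proof. decide equality; decide equality. Qed.

Lemma locally_plane_time (T : R) (c d : coord) (p : point) (y z : R) :
  0 < get Time (plane_point c d p (y, z)) < T ->
  locally (y, z) (fun yz => 0 < get Time (plane_point c d p yz) < T).
Proof.
intros Hp.
assert (Htime : continuous (fun yz => get Time (plane_point c d p yz)) (y, z)).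
{ apply (continuous_ext (fun yz => snd (plane_point c d p yz))).
  - intros yz; now destruct (plane_point c d p yz) as [[[x1 x2] x3] t].
  - apply (continuous_comp (plane_point c d p) snd);
      [apply continuous_plane_point|apply continuous_snd]. }
apply (Htime (fun t => 0 < t < T)).
apply (open_and (fun t => 0 < t) (fun t => t < T));
  [apply open_gt|apply open_lt|exact Hp].
Qed.

(** Schwarz's theorem, applied in the coordinate plane through [p] in the
    directions [c] and [d]. *)
Lemma pd_comm (T : R) (u : point -> R) (c d : coord) (p : point) :
  smooth T u -> 0 < get Time p < T -> pd c (pd d u) p = pd d (pd c u) p.
Proof.
intros Hu Hp.
destruct (coord_eq_dec c d) as [->|Hcd]; [reflexivity|].
rewrite <- (plane_point_get c d p) in Hp |- *.
set (y0 := get c p) in *; set (z0 := get d p) in *.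
pose (U y z := u (plane_point c d p (y, z))).
assert (Hl : forall y z,
  Derive (fun y => U y z) y = pd c u (plane_point c d p (y, z)))
  by (intros; apply pd_plane_l).
assert (Hr : forall y z,
  Derive (fun z => U y z) z = pd d u (plane_point c d p (y, z)))
  by (intros; now apply pd_plane_r).
assert (Hlr : forall y z,
  Derive (fun y => Derive (fun z => U y z) z) y
  = pd c (pd d u) (plane_point c d p (y, z))).
{ intros y z; rewrite <- pd_plane_l; apply Derive_ext; intros; apply Hr. }
assert (Hrl : forall y z,
  Derive (fun z => Derive (fun y => U y z) y) z
  = pd d (pd c u) (plane_point c d p (y, z))).
{ intros y z; rewrite <- pd_plane_r by assumption.
  apply Derive_ext; intros; apply Hl. }
rewrite <- Hlr, <- Hrl.
apply (Schwarz U y0 z0).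
- apply locally_2d_locally.
  generalize (locally_plane_time T c d p y0 z0 Hp).
  apply filter_imp; intros [y z] Hyz; simpl.
  repeat split.
  + apply ex_pd_plane_l; now apply (smooth_ex_pd T).
  + apply ex_pd_plane_r; [assumption|now apply (smooth_ex_pd T)].
  + apply (ex_derive_ext (fun y => pd d u (plane_point c d p (y, z))));
      [intros; symmetry; apply Hr|].
    apply ex_pd_plane_l; apply (smooth_ex_pd T); auto using smooth_pd.
  + apply (ex_derive_ext (fun z => pd c u (plane_point c d p (y, z))));
      [intros; symmetry; apply Hl|].
    apply ex_pd_plane_r; [assumption|].
    apply (smooth_ex_pd T); auto using smooth_pd.
- apply (continuity_2d_pt_ext
    (fun y z => pd c (pd d u) (plane_point c d p (y, z))));
    [intros; symmetry; apply Hlr|].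
  apply continuity_2d_plane, (Hu (c :: d :: nil)); assumption.
- apply (continuity_2d_pt_ext
    (fun y z => pd d (pd c u) (plane_point c d p (y, z))));
    [intros; symmetry; apply Hrl|].
  apply continuity_2d_plane, (Hu (d :: c :: nil)); assumption.
Qed.

(** * The operators of the moving frame *)

Section Operators.

Context (T : R) (v : axis -> point -> R) (psi : point -> R) (p : point).
Hypothesis v_smooth : forall i, smooth T (v i).
Hypothesis psi_smooth : smooth T psi.
Hypothesis p_time : 0 < get Time p < T.
Hypothesis J_neq0 : J psi p <> 0.

Lemma ex_pd_a (c : coord) (k i : axis) : ex_pd c (a psi k i) p.
Proof.
assert (Hpd : forall j : axis, ex_pd c (pd j psi) p)
  by (intros j; apply (smooth_ex_pd T); auto using smooth_pd).
destruct k, i; try exact (ex_pd_const c _ p);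
  apply (ex_pd_div c _ (pd X3 psi)); auto using ex_pd_const, ex_pd_opp.
Qed.

Lemma ex_pd_grad_a (c : coord) (u : point -> R) (i : axis) :
  (forall k : axis, ex_pd c (pd k u) p) -> ex_pd c (grad_a psi u i) p.
Proof. intros Hu; apply ex_pd_sum3; auto using ex_pd_mult, ex_pd_a. Qed.

Lemma pd_grad_a (c : coord) (u : point -> R) (i : axis) :
  (forall k : axis, ex_pd c (pd k u) p) ->
  pd c (grad_a psi u i) p
  = sum3 (fun k => pd c (a psi k i) p * pd k u p
                   + a psi k i p * pd c (pd k u) p).
Proof.
intros Hu; unfold grad_a.
rewrite (pd_sum3 c (fun k x => a psi k i x * pd k u x))
  by auto using ex_pd_mult, ex_pd_a.
apply sum3_ext; intros k; apply pd_mult; auto using ex_pd_a.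
Qed.

Lemma ex_pd_advection (c : coord) (i k : axis) :
  ex_pd c (fun x => v i x * a psi k i x) p.
Proof.
apply ex_pd_mult; [now apply (smooth_ex_pd T)|apply ex_pd_a].
Qed.

Lemma ex_pd_frame_speed (c : coord) :
  ex_pd c (fun x => pd Time psi x * a psi X3 X3 x) p.
Proof.
apply ex_pd_mult; [|apply ex_pd_a].
apply (smooth_ex_pd T); auto using smooth_pd.
Qed.

Lemma ex_pd_Q (c : coord) (u : point -> R) :
  (forall d, ex_pd c (pd d u) p) -> ex_pd c (Q v psi u) p.
Proof.
intros Hu.
apply (ex_pd_minus c (fun x => pd Time u x + sum3 (fun i => sum3 (fun k =>
    v i x * a psi k i x * pd k u x)))
  (fun x => pd Time psi x * a psi X3 X3 x * pd X3 u x)).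
- apply (ex_pd_plus c (pd Time u)); [apply Hu|].
  apply (ex_pd_sum3 c (fun i x => sum3 (fun k =>
    v i x * a psi k i x * pd k u x))); intros i.
  apply (ex_pd_sum3 c (fun k x => v i x * a psi k i x * pd k u x)); intros k.
  apply (ex_pd_mult c (fun x => v i x * a psi k i x));
    auto using ex_pd_advection.
- apply (ex_pd_mult c (fun x => pd Time psi x * a psi X3 X3 x));
    auto using ex_pd_frame_speed.
Qed.

Lemma pd_Q (c : coord) (u : point -> R) :
  (forall d, ex_pd c (pd d u) p) ->
  pd c (Q v psi u) p
  = pd c (pd Time u) p
    + sum3 (fun i => sum3 (fun k =>
        pd c (fun x => v i x * a psi k i x) p * pd k u p
        + v i p * a psi k i p * pd c (pd k u) p))
    - (pd c (fun x => pd Time psi x * a psi X3 X3 x) p * pd X3 u p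
       + pd Time psi p * a psi X3 X3 p * pd c (pd X3 u) p).
Proof.
intros Hu.
assert (Hterm : forall i k,
  ex_pd c (fun x => v i x * a psi k i x * pd k u x) p).
{ intros i k; apply (ex_pd_mult c (fun x => v i x * a psi k i x));
    auto using ex_pd_advection. }
assert (Hrow : forall i, ex_pd c (fun x => sum3 (fun k =>
  v i x * a psi k i x * pd k u x)) p).
{ intros i.
  apply (ex_pd_sum3 c (fun k x => v i x * a psi k i x * pd k u x)); auto. }
unfold Q.
rewrite (pd_minus c (fun x => pd Time u x + sum3 (fun i => sum3 (fun k =>
    v i x * a psi k i x * pd k u x)))
  (fun x => pd Time psi x * a psi X3 X3 x * pd X3 u x)).
- f_equal.
  + rewrite (pd_plus c (pd Time u)); [f_equal|apply Hu|].
    * rewrite (pd_sum3 c (fun i x => sum3 (fun k =>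
        v i x * a psi k i x * pd k u x))) by assumption.
      apply sum3_ext; intros i.
      rewrite (pd_sum3 c (fun k x => v i x * a psi k i x * pd k u x)) by auto.
      apply sum3_ext; intros k.
      apply (pd_mult c (fun x => v i x * a psi k i x));
        auto using ex_pd_advection.
    * now apply (ex_pd_sum3 c (fun i x => sum3 (fun k =>
        v i x * a psi k i x * pd k u x))).
  + apply (pd_mult c (fun x => pd Time psi x * a psi X3 X3 x));
      auto using ex_pd_frame_speed.
- apply (ex_pd_plus c (pd Time u)); [apply Hu|].
  now apply (ex_pd_sum3 c (fun i x => sum3 (fun k =>
    v i x * a psi k i x * pd k u x))).
- apply (ex_pd_mult c (fun x => pd Time psi x * a psi X3 X3 x));
    auto using ex_pd_frame_speed.
Qed.

(** In both compositions the second derivatives of [u] carry the same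
    coefficients, those of $\nabla_a$ times those of $Q$, and cancel by
    Schwarz's theorem.  What remains has one derivative on a coefficient:
    $\nabla_a$ falling on the coefficients of $Q$, minus $Q$ falling on those
    of $\nabla_a$. *)
Lemma grad_a_Q_commutator (u : point -> R) (i : axis) :
  smooth T u ->
  grad_a psi (Q v psi u) i p - Q v psi (grad_a psi u i) p
  = - sum3 (fun j => pd Time (a psi j i) p * pd j u p)
    + sum3 (fun j => sum3 (fun k => sum3 (fun m =>
        a psi m i p * pd m (fun x => v j x * a psi k j x) p * pd k u p)))
    - sum3 (fun j => sum3 (fun k => sum3 (fun m =>
        pd k (a psi m i) p * v j p * a psi k j p * pd m u p)))
    - sum3 (fun m =>
        a psi m i p * pd m (fun x => pd Time psi x * a psi X3 X3 x) p
        * pd X3 u p)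
    + sum3 (fun m =>
        pd X3 (a psi m i) p * pd Time psi p * a psi X3 X3 p * pd m u p).
Proof.
intros Hu.
assert (Hpd : forall c d, ex_pd c (pd d u) p)
  by (intros; apply (smooth_ex_pd T); auto using smooth_pd).
replace (grad_a psi (Q v psi u) i p) with
  (sum3 (fun m => a psi m i p * pd m (Q v psi u) p)) by reflexivity.
unfold Q at 2.
unfold sum3.
rewrite !pd_Q, !pd_grad_a by auto.
unfold sum3.
rewrite (pd_comm T u X2 X1), (pd_comm T u X3 X1), (pd_comm T u X3 X2),
  (pd_comm T u X1 Time), (pd_comm T u X2 Time), (pd_comm T u X3 Time)
  by assumption.
ring.
Qed.

End Operators.

Lemma sum3_opp (u : axis -> R) : sum3 (fun i => - u i) = - sum3 u.
Proof. unfold sum3; ring. Qed.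

Lemma sum3_minus (u1 u2 : axis -> R) :
  sum3 (fun i => u1 i - u2 i) = sum3 u1 - sum3 u2.
Proof. unfold sum3; ring. Qed.

Lemma sum3_plus (u1 u2 : axis -> R) :
  sum3 (fun i => u1 i + u2 i) = sum3 u1 + sum3 u2.
Proof. unfold sum3; ring. Qed.

(** This is where $F$ comes from: it is $[\nabla_{a,i}, Q]$ applied to $v_i$
    and summed over $i$. *)
Lemma div_a_Q_commutator (T : R) (v : axis -> point -> R) (psi : point -> R)
    (p : point) :
  (forall i, smooth T (v i)) -> smooth T psi -> 0 < get Time p < T ->
  J psi p <> 0 ->
  sum3 (fun i => grad_a psi (Q v psi (v i)) i p)
  - sum3 (fun i => Q v psi (grad_a psi (v i) i) p)
  = source_F v psi p.
Proof.
intros Hv Hpsi Hp HJ; rewrite <- sum3_minus.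
rewrite (sum3_ext _ _ (fun i =>
  grad_a_Q_commutator T v psi p Hv Hpsi Hp HJ (v i) i (Hv i))).
now rewrite sum3_plus, !sum3_minus, sum3_plus, sum3_opp.
Qed.

(** * The first-order system for the logarithm of the density *)

Section Solution.

Context (L T : R) (q : R -> R) (v : axis -> point -> R) (rho : point -> R)
  (w : R * R * R -> R) (psi : point -> R).
Hypothesis solution : euler_plate_solution L T q v rho w psi.
Hypothesis q_smooth : forall (n : nat) (r : R), 0 < r -> ex_derive_n q n r.

Let g (p : point) : R := ln (rho p).
Let f (p : point) : R := Derive q (rho p).

Lemma J_neq0_Omega (p : point) : Omega T p -> J psi p <> 0.
Proof. intros Hp; generalize (J_pos _ _ _ _ _ _ _ solution p Hp); lra. Qed.

Lemma pd_log_density (c : coord) (p : point) :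
  Omega T p -> pd c g p = pd c rho p / rho p.
Proof.
intros Hp; apply pd_ln.
- exact (rho_pos _ _ _ _ _ _ _ solution p Hp).
- exact (smooth_ex_pd T rho c p (rho_smooth _ _ _ _ _ _ _ solution) (proj2 Hp)).
Qed.

Lemma ex_pd_pd_log_density (c d : coord) (p : point) :
  Omega T p -> ex_pd c (pd d g) p.
Proof.
intros Hp; apply (ex_pd_pd_ln T).
- exact (rho_smooth _ _ _ _ _ _ _ solution).
- exact (proj2 Hp).
- exact (rho_pos _ _ _ _ _ _ _ solution p Hp).
Qed.

Lemma pd_pressure (c : coord) (p : point) :
  Omega T p -> pd c (fun x => q (rho x)) p = f p * pd c rho p.
Proof.
intros Hp; apply pd_comp.
- exact (q_smooth 1 _ (rho_pos _ _ _ _ _ _ _ solution p Hp)).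
- exact (smooth_ex_pd T rho c p (rho_smooth _ _ _ _ _ _ _ solution) (proj2 Hp)).
Qed.

Lemma ex_pd_sound_speed (c : coord) (p : point) : Omega T p -> ex_pd c f p.
Proof.
intros Hp; apply (ex_pd_comp c (Derive q)).
- exact (q_smooth 2 _ (rho_pos _ _ _ _ _ _ _ solution p Hp)).
- exact (smooth_ex_pd T rho c p (rho_smooth _ _ _ _ _ _ _ solution) (proj2 Hp)).
Qed.

Lemma Q_log_density (p : point) :
  Omega T p -> Q v psi g p = - div_a psi v p.
Proof.
intros Hp.
assert (Hrho := rho_pos _ _ _ _ _ _ _ solution p Hp).
assert (Hmass := mass _ _ _ _ _ _ _ solution p Hp).
apply (Rmult_eq_reg_l (rho p)); [|lra].
unfold Q, div_a; unfold sum3 in *; rewrite !pd_log_density by assumption.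
apply Rminus_diag_uniq.
rewrite <- Hmass; field; lra.
Qed.

Lemma log_density_flux (i : axis) (p : point) :
  Omega T p -> f p * grad_a psi g i p = - Q v psi (v i) p.
Proof.
intros Hp.
assert (Hrho := rho_pos _ _ _ _ _ _ _ solution p Hp).
assert (Hmom := momentum _ _ _ _ _ _ _ solution i p Hp).
unfold grad_a, Q; unfold sum3 in *.
rewrite !pd_log_density by assumption.
rewrite !pd_pressure in Hmom by assumption.
apply Rminus_diag_uniq.
rewrite <- Hmom; field; lra.
Qed.

Lemma ex_pd_pd_velocity (c d : coord) (i : axis) (p : point) :
  Omega T p -> ex_pd c (pd d (v i)) p.
Proof.
intros Hp; apply (smooth_ex_pd T); [|exact (proj2 Hp)].
apply smooth_pd, (v_smooth _ _ _ _ _ _ _ solution).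
Qed.

(** The outer derivatives on the left see $Qg$ and $f\nabla_a g$ only through
    their values on $\Omega$, where the mass and momentum equations replace
    them by $-\operatorname{div}_a v$ and $-Qv$. *)
Lemma wave_equation (p : point) :
  Omega T p ->
  Q v psi (Q v psi g) p - div_a psi (fun i x => f x * grad_a psi g i x) p
  = source_F v psi p.
Proof.
intros Hp.
assert (Hv := v_smooth _ _ _ _ _ _ _ solution).
assert (Hpsi := psi_smooth _ _ _ _ _ _ _ solution).
assert (HJ := J_neq0_Omega p Hp).
assert (Hdiv : forall c i, ex_pd c (grad_a psi (v i) i) p).
{ intros c i; apply (ex_pd_grad_a T); try assumption; [exact (proj2 Hp)|].
  intros k; now apply ex_pd_pd_velocity. }
assert (HQg : forall c, pd c (Q v psi g) p
  = - sum3 (fun i => pd c (grad_a psi (v i) i) p)).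
{ intros c.
  rewrite <- (pd_sum3 c (fun i => grad_a psi (v i) i)), <- pd_opp by auto.
  apply (pd_eq_of_non_isolated (Omega T)).
  - now apply Omega_non_isolated.
  - exact Q_log_density.
  - apply (ex_pd_Q T); try assumption; [exact (proj2 Hp)|].
    intros d; now apply ex_pd_pd_log_density.
  - apply ex_pd_opp, (ex_pd_sum3 c (fun i => grad_a psi (v i) i)); auto. }
assert (Hflux : forall c i, pd c (fun x => f x * grad_a psi g i x) p
  = - pd c (Q v psi (v i)) p).
{ intros c i; rewrite <- pd_opp.
  apply (pd_eq_of_non_isolated (Omega T)).
  - now apply Omega_non_isolated.
  - apply log_density_flux.
  - apply ex_pd_mult; [now apply ex_pd_sound_speed|].
    apply (ex_pd_grad_a T); try assumption; [exact (proj2 Hp)|].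
    intros k; now apply ex_pd_pd_log_density.
  - apply ex_pd_opp, (ex_pd_Q T); try assumption; [exact (proj2 Hp)|].
    intros d; now apply ex_pd_pd_velocity. }
rewrite <- (div_a_Q_commutator T v psi p Hv Hpsi (proj2 Hp) HJ).
assert (HQQ : Q v psi (Q v psi g) p
  = - sum3 (fun i => Q v psi (grad_a psi (v i) i) p)).
{ unfold Q at 1, Q; unfold sum3; fold g; rewrite !HQg; unfold sum3; ring. }
assert (Hdivflux : div_a psi (fun i x => f x * grad_a psi g i x) p
  = - sum3 (fun i => grad_a psi (Q v psi (v i)) i p)).
{ unfold div_a, grad_a at 2; unfold sum3 at 1 2 3 4; rewrite !Hflux.
  unfold sum3; ring. }
rewrite HQQ, Hdivflux; ring.
Qed.

(** * The boundary conditions *)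

Lemma Gamma1_Omega (p : point) : Gamma1 T p -> Omega T p.
Proof. intros [Hx Ht]; split; [rewrite Hx; lra|exact Ht]. Qed.

Lemma Gamma0_Omega (p : point) : Gamma0 T p -> Omega T p.
Proof. intros [Hx Ht]; split; [rewrite Hx; lra|exact Ht]. Qed.

(** The top boundary is carried by the flow: its vertical velocity $\psi_t$ is
    $w_t$, which is the flux $b_{3i}v_i$. *)
Lemma Q_tangent_top (p : point) :
  Gamma1 T p ->
  sum3 (fun i => v i p * a psi X3 i p) = pd Time psi p * a psi X3 X3 p.
Proof.
intros Hp.
assert (HJ := J_neq0_Omega p (Gamma1_Omega p Hp)).
assert (Hpsi_t : pd Time psi p = pd Time (lift w) p).
{ assert (Hw : ex_pd Time (lift w) p)
    by exact (smooth_ex_pd T _ Time p (w_smooth _ _ _ _ _ _ _ solution)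
      (proj2 Hp)).
  rewrite (pd_eq_of_non_isolated (Gamma1 T) Time psi
    (fun x => 1 + lift w x) p).
  - rewrite pd_plus, pd_const by auto using ex_pd_const; ring.
  - now apply Gamma1_non_isolated.
  - exact (psi_top _ _ _ _ _ _ _ solution).
  - exact (smooth_ex_pd T _ Time p (psi_smooth _ _ _ _ _ _ _ solution)
      (proj2 Hp)).
  - auto using ex_pd_plus, ex_pd_const. }
rewrite Hpsi_t, (kinematic_top _ _ _ _ _ _ _ solution p Hp).
unfold J in HJ; unfold sum3; simpl; field; exact HJ.
Qed.

Lemma ex_pd_nu (c : coord) (i : axis) (p : point) :
  Omega T p -> ex_pd c (nu psi i) p.
Proof.
intros Hp.
assert (Hpd : forall j : axis, ex_pd c (pd j psi) p).
{ intros j; apply (smooth_ex_pd T); [|exact (proj2 Hp)].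
  apply smooth_pd, (psi_smooth _ _ _ _ _ _ _ solution). }
destruct i; [apply ex_pd_opp, Hpd|apply ex_pd_opp, Hpd|].
exact (ex_pd_const c 1 p).
Qed.

(** The kinematic condition holds on the top boundary only, so it may be
    differentiated in time and in the horizontal directions only. *)
Lemma pd_kinematic_top (c : coord) (p : point) :
  c <> X3 -> Gamma1 T p ->
  pd c (pd Time (lift w)) p
  = sum3 (fun i => pd c (b psi X3 i) p * v i p
                   + b psi X3 i p * pd c (v i) p).
Proof.
intros Hc Hp.
assert (Hv : forall i, ex_pd c (v i) p).
{ intros i; exact (smooth_ex_pd T _ c p (v_smooth _ _ _ _ _ _ _ solution i)
    (proj2 Hp)). }
assert (Hb : forall i, ex_pd c (b psi X3 i) p)
  by (intros i; apply ex_pd_nu, Gamma1_Omega, Hp).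
assert (Hbv : forall i, ex_pd c (fun x => b psi X3 i x * v i x) p)
  by auto using ex_pd_mult.
rewrite (pd_eq_of_non_isolated (Gamma1 T) c (pd Time (lift w))
  (fun x => sum3 (fun i => b psi X3 i x * v i x)) p).
- rewrite (pd_sum3 c (fun i x => b psi X3 i x * v i x)) by assumption.
  apply sum3_ext; intros i; now apply pd_mult.
- now apply Gamma1_non_isolated.
- exact (kinematic_top _ _ _ _ _ _ _ solution).
- apply (smooth_ex_pd T); [|exact (proj2 Hp)].
  apply smooth_pd, (w_smooth _ _ _ _ _ _ _ solution).
- now apply (ex_pd_sum3 c (fun i x => b psi X3 i x * v i x)).
Qed.

Lemma flux_top (p : point) :
  Gamma1 T p ->
  sum3 (fun i => f p * grad_a psi g i p * nu psi i p) = boundary_h v w psi p.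
Proof.
intros Hp.
assert (HO := Gamma1_Omega p Hp).
assert (Htangent := Q_tangent_top p Hp).
rewrite (sum3_ext _ (fun i => - Q v psi (v i) p * b psi X3 i p))
  by (intros i; now rewrite log_density_flux).
unfold boundary_h, Q; rewrite <- Htangent.
unfold sum2; rewrite !pd_kinematic_top by (assumption || discriminate).
unfold sum3; ring.
Qed.

Hypothesis q_increasing : forall p, Omega T p -> 0 < Derive q (rho p).

(** On the bottom $\psi$ and $v_3$ vanish identically, hence so do their time
    and horizontal derivatives, and with them $a_{31}$, $a_{32}$ and the
    coefficient of $\partial_3$ in $Q$.  The third momentum equation is left
    with the vertical pressure gradient alone. *)
Lemma neumann_bottom (p : point) : Gamma0 T p -> pd X3 g p = 0.
Proof.
intros Hp.
assert (HO := Gamma0_Omega p Hp).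
assert (HJ := J_neq0_Omega p HO).
assert (Hzero : forall (u : point -> R) (c : coord), smooth T u ->
  (forall x, Gamma0 T x -> u x = 0) -> c <> X3 -> pd c u p = 0).
{ intros u c Hu H0 Hc.
  rewrite (pd_eq_of_non_isolated (Gamma0 T) c u (fun _ => 0) p).
  - apply pd_const.
  - now apply Gamma0_non_isolated.
  - exact H0.
  - exact (smooth_ex_pd T u c p Hu (proj2 Hp)).
  - apply ex_pd_const. }
assert (Hpsi : forall c : coord, c <> X3 -> pd c psi p = 0).
{ intros c; apply Hzero; [exact (psi_smooth _ _ _ _ _ _ _ solution)|].
  exact (psi_bottom _ _ _ _ _ _ _ solution). }
assert (Hv3 : forall c : coord, c <> X3 -> pd c (v X3) p = 0).
{ intros c; apply Hzero; [exact (v_smooth _ _ _ _ _ _ _ solution X3)|].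
  exact (kinematic_bottom _ _ _ _ _ _ _ solution). }
assert (Hflux := log_density_flux X3 p HO).
unfold grad_a, Q, sum3 in Hflux; simpl in Hflux.
rewrite (Hv3 Time), (Hv3 X1), (Hv3 X2), (Hpsi Time), (Hpsi X1), (Hpsi X2),
  (kinematic_bottom _ _ _ _ _ _ _ solution p Hp) in Hflux by discriminate.
assert (Hf := q_increasing p HO); fold (f p) in Hf.
unfold J in HJ.
apply (Rmult_eq_reg_l (f p / pd X3 psi p)).
- transitivity (f p * (0 * pd X1 g p + 0 * pd X2 g p
    + 1 / pd X3 psi p * pd X3 g p)); [field; exact HJ|].
  rewrite Hflux; field; exact HJ.
- apply Rmult_integral_contrapositive_currified; [lra|].
  now apply Rinv_neq_0_compat.
Qed.

End Solution.

Theorem theorem6p1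
  (L T m0 M0 c1 c2 : R) (q : R -> R)
  (v : axis -> point -> R) (rho : point -> R) (w : R * R * R -> R)
  (psi : point -> R)
  (L_pos : 0 < L) (T_pos : 0 < T)
  (m0_pos : 0 < m0) (M0_pos : 0 < M0) (c1_pos : 0 < c1) (c2_pos : 0 < c2)
  (q_smooth : forall (n : nat) (r : R), 0 < r -> ex_derive_n q n r)
  (q_bounds : forall r : R, m0 / 2 <= r <= 2 * M0 -> c1 <= Derive q r <= c2)
  (solution : euler_plate_solution L T q v rho w psi)
  (rho_range : forall p : point, Omega T p -> m0 / 2 <= rho p <= 2 * M0) :
  let g : point -> R := fun p => ln (rho p) in
  let f : point -> R := fun p => Derive q (rho p) in
  (forall p : point, Omega T p ->
     Q v psi (Q v psi g) p
     - div_a psi (fun i x => f x * grad_a psi g i x) p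
     = source_F v psi p) /\
  (forall p : point, Gamma1 T p ->
     sum3 (fun i => f p * grad_a psi g i p * nu psi i p)
     = boundary_h v w psi p) /\
  (forall p : point, Gamma0 T p -> pd X3 g p = 0).
Proof.
intros g f.
assert (q_increasing : forall p, Omega T p -> 0 < Derive q (rho p)).
{ intros p Hp; generalize (q_bounds _ (rho_range p Hp)); lra. }
split; [|split]; intros p Hp.
- exact (wave_equation L T q v rho w psi solution q_smooth p Hp).
- exact (flux_top L T q v rho w psi solution q_smooth p Hp).
- exact (neumann_bottom L T q v rho w psi solution q_smooth q_increasing p Hp).
Qed.
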